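(* Let $S$ be a numerical semigroup of depth $2$. If $S$ has at most $3$ small elements, then $S$ is $\lambda$-minimal.
   Context: $\mathbb{N}=\{0,1,2,\dots\}$. A numerical set is a subset $T\subseteq\mathbb{N}$ with $0\in T$ and finite complement in $\mathbb{N}$. Its gaps are the elements of $\mathrm{G}(T)=\mathbb{N}\setminus T$; the largest gap is the Frobenius number $\mathrm{F}(T)$; the smallest nonzero element of $T$ is its multiplicity $\mathrm{m}(T)$; the depth of $T$ is the unique nonnegative integer $\mathrm{q}(T)$ with $(\mathrm{q}(T)-1)\,\mathrm{m}(T)\le \mathrm{F}(T)<\mathrm{q}(T)\,\mathrm{m}(T)$. A numerical semigroup is a numerical set closed under addition. The small elements of a numerical semigroup $S$ are the positive elements of $S$ that are less than $\mathrm{F}(S)$ (so $0$ is not counted). The enumeration $\lambda(T)$ of a numerical set $T$ is the integer partition whose Young diagram has as its profile (lower-right boundary) the lattice walk that, for $n=0,1,2,\dots,\mathrm{F}(T)$, takes a unit step right if $n\in T$ and a unit step up if $n\notin T$. Equivalently, the parts of $\lambda(T)$ are the numbers $\#\{u\in T: u<x\}$, one for each gap $x\in\mathrm{G}(T)$. The size $|\lambda|$ of a partition is the sum of its parts. The hook length of a box in the Young diagram of a partition $\lambda$ is the number of boxes to its right in the same row plus the number of boxes below it in the same column plus $1$; $\mathrm{H}(\lambda)$ is the set of all hook lengths of $\lambda$. For a numerical semigroup $S$, $\mathcal{P}(S)=\{\lambda:\mathrm{H}(\lambda)=\mathbb{N}\setminus S\}$; it is known that $\lambda(S)\in\mathcal{P}(S)$.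 $S$ is $\lambda$-minimal if $|\lambda(S)|\le|\lambda|$ for all $\lambda\in\mathcal{P}(S)$. *)

(* Defs.v *)
From HB Require Import structures.
From mathcomp Require Import all_boot all_order all_algebra finmap.
From mathcomp Require Import boolp classical_sets functions cardinality.

Set Implicit Arguments.
Unset Strict Implicit.
Unset Printing Implicit Defensive.

Import Order.TTheory GRing.Theory Num.Theory.

Local Open Scope classical_set_scope.
Local Open Scope nat_scope.

Definition gaps (T : set nat) : set nat := ~` T.

Definition numerical_set (T : set nat) : Prop := T 0 /\ finite_set (gaps T).

Definition numerical_semigroup (S : set nat) : Prop :=
  numerical_set S /\ (forall x y, S x -> S y -> S (x + y)).

(* The shift by one gives -1 when there are no gaps, the usual convention, for
   which the whole of nat has depth 0. *)
Definition frobenius (T : set nat) : int :=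
  ((\max_(x <- fset_set (gaps T)) x.+1)%N%:Z - 1)%R.

Definition is_multiplicity (T : set nat) (m : nat) : Prop :=
  [/\ T m, 0 < m & forall n, T n -> 0 < n -> m <= n].

Definition multiplicity (T : set nat) : nat := get (is_multiplicity T).

Definition has_depth (T : set nat) (q : nat) : Prop :=
  ((q%:Z - 1) * (multiplicity T)%:Z <= frobenius T < q%:Z * (multiplicity T)%:Z)%R.

Definition small_elements (S : set nat) : set nat :=
  [set s | [/\ S s, 0 < s & (s%:Z < frobenius S)%R]].

(* A partition is the list of its parts in nonincreasing order; row [i] of its
   Young diagram (English convention, rows and columns counted from 0) has
   [nth 0 la i] boxes. *)
Definition is_partition (la : seq nat) : bool := sorted geq la && (0 \notin la).

Definition in_diagram (la : seq nat) (i j : nat) : bool := j < nth 0 la i.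

Definition arm (la : seq nat) (i j : nat) : nat := nth 0 la i - j.+1.

Definition leg (la : seq nat) (i j : nat) : nat :=
  count (fun k => in_diagram la k j) (iota i.+1 (size la - i.+1)).

Definition hook_length (la : seq nat) (i j : nat) : nat :=
  arm la i j + leg la i j + 1.

Definition hook_lengths (la : seq nat) : set nat :=
  [set h | exists i j, in_diagram la i j /\ h = hook_length la i j].

(* The profile of the diagram, walked from its lower left corner, goes right at
   step [n] if [T n] and up otherwise.  An up step [x] therefore closes a row,
   whose length is the number of right steps taken before it. *)
Definition enumeration (T : set nat) : seq nat :=
  sort geq [seq count (fun u => u \in T) (iota 0 x) | x <- fset_set (gaps T)].

Definition partitions_with_gaps (S : set nat) : set (seq nat) :=
  [set la | is_partition la /\ hook_lengths la = gaps S].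

Definition lambda_minimal (S : set nat) : Prop :=
  forall la, partitions_with_gaps S la -> sumn (enumeration S) <= sumn la.

(* Main.v *)
Require Import Defs.
From mathcomp Require Import all_boot all_order all_algebra finmap.
From mathcomp Require Import boolp classical_sets functions cardinality.
From mathcomp Require Import zify.

(** A partition [la] is read off the profile of its diagram, as the numerical set
    [T] of the right steps: a box of the diagram is a pair [(u, x)] with [u] in
    [T], [x] outside [T] and [u < x], and its hook length is [x - u].  The size of
    [la] is thus the number of such pairs, and the hook lengths of [la] are the
    gaps of [S] exactly when [S] is the set of all [s] with [s + T] contained in
    [T].  Then [T] contains [S] and has the same Frobenius number [F], so the
    task is to inject the boxes of [S] into the boxes of [T].

    Put [D = T \ S].  The pairs [(s, h)] with [h] outside [T] are boxes of both
    sets and stay where they are.  There remain the boxes [(s, h)] of [S] with [h]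
    in [D].
    - If [F - h] is in [D], reflect the box to [(F - h, F - s)]; the point [F - s]
      is outside [T] because adding [s] to it gives [F].
    - If [F - h] is not in [D] and [s = 0], use [(h, F)].
    - If [F - h] is not in [D] and [s] is a small element, then, since [h] is a
      hook length, there is [t] in [T] with [h + t] outside [T], and [t] is in [D].
      This provides three boxes of [T], namely [(h, h + t)], [(t, h + t)] and
      [(t, h - b + t)], where [b] is the largest small element; the third needs
      [b < h], so it is given to [s = b], and the other two are given to the other
      small elements.  Three small elements are therefore all that can be served.

    Depth 2 says that two positive elements of [S] add up to more than [F].  This
    separates the images of the last kind from the others, as [F - y] is in [S] for
    a box [(x, y)] of the first two kinds and not for the last kind, and separates
    the three boxes of the last kind from one another: [t < F - s < s < h], and
    [h - b + t] is less than [F - b] while [h + t] is greater.  The injection is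
    [move_box], its inverse is [unmove_box], and [size_boxes_le] is the resulting
    inequality; [sumn_boxes] and [hook_lengthsP] are the dictionary between a
    partition and its numerical set. *)

Set Implicit Arguments.
Unset Strict Implicit.
Unset Printing Implicit Defensive.

Local Open Scope classical_set_scope.
Local Open Scope card_scope.

(** * Boxes of a numerical set *)

Definition boxes (T : pred nat) (N : nat) : seq (nat * nat) :=
  [seq (u, x) | x <- [seq x <- iota 0 N | ~~ T x], u <- [seq u <- iota 0 x | T u]].

Lemma mem_boxes T N u x :
  ((u, x) \in boxes T N) = [&& T u, ~~ T x, u < x & x < N].
Proof.
apply/allpairsPdep/idP => [[x' [u' [+ + [-> ->]]]]|/and4P[Tu Tx ux xN]].
  by rewrite !mem_filter !mem_iota /= !add0n => /andP[-> ->] /andP[-> ->].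
by exists x, u; rewrite !mem_filter !mem_iota /= !add0n Tu Tx ux xN.
Qed.

Lemma uniq_boxes T N : uniq (boxes T N).
Proof.
apply: allpairs_uniq_dep => [|x _|]; rewrite ?filter_uniq ?iota_uniq //.
by move=> [x u] [x' u'] _ _ /= [-> ->].
Qed.

Lemma size_boxes T N :
  size (boxes T N) =
  sumn [seq count T (iota 0 x) | x <- [seq x <- iota 0 N | ~~ T x]].
Proof.
by rewrite size_allpairs_dep; congr sumn; apply: eq_map => x; rewrite size_filter.
Qed.

Lemma size_boxes_perm (T : pred nat) N xs :
  uniq xs -> (forall x, (x \in xs) = ~~ T x && (x < N)) ->
  size (boxes T N) = sumn [seq count T (iota 0 x) | x <- xs].
Proof.
move=> xsU xsE; rewrite size_boxes; apply: perm_sumn; apply: perm_map.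
apply: uniq_perm; rewrite ?filter_uniq ?iota_uniq // => x.
by rewrite mem_filter mem_iota add0n leq0n xsE.
Qed.

(** * The injection *)

(** Meant for small elements [a] and [b] of [S], with [b] the largest, and for [t]
    such that [t h] is in [T] and [h + t h] is not, for all [h] in [T] outside
    [S]. *)
Definition move_box (S T : pred nat) (F b a : nat) (t : nat -> nat)
    (p : nat * nat) : nat * nat :=
  let: (s, h) := p in
  if ~~ T h then (s, h)
  else if T (F - h) && ~~ S (F - h) then (F - h, F - s)
  else if s == 0 then (h, F)
  else if s == b then (t h, h - b + t h)
  else if s == a then (h, h + t h)
  else (t h, h + t h).

(** The branch that [move_box] took is visible on its value [(x, y)]: only unmoved
    boxes have [x] in [S], of the others only those of the next two branches have
    [F - y] in [S], and the size of [y] or the order of [x] and [y - x] tells the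
    last three apart. *)
Definition unmove_box (S T : pred nat) (F b a a' : nat) (p : nat * nat) :
    nat * nat :=
  let: (x, y) := p in
  if S x then (x, y)
  else if S (F - y) then
    if T (F - x) && ~~ S (F - x) then (F - y, F - x) else (0, x)
  else if y + b < F then (b, y + b - x)
  else if y - x < x then (a, x)
  else (a', y - x).

(** The hypothesis on [s + s] is the form in which depth 2 acts: it makes any two
    positive elements of [S] add up to more than [F]. *)
Lemma size_boxes_le (S T : pred nat) (F b a a' : nat) :
  S 0 -> ~~ T F -> (forall x, F < x -> T x) ->
  (forall s t, S s -> T t -> T (s + t)) -> T 0 ->
  (forall h, T h -> ~~ S h -> exists2 t, T t & ~~ T (h + t)) ->
  (forall s, S s -> 0 < s -> F < s + s) ->
  S b -> 0 < b ->
  (forall s, S s -> 0 < s -> s < F -> s <= b /\ [|| s == b, s == a | s == a']) ->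
  size (boxes S F.+1) <= size (boxes T F.+1).
Proof.
move=> S0 TF Tbig ST T0 Twit Sdepth Sb b_gt0 Ssmall.
have /choice[t tP] h : exists t, T h -> ~~ S h -> T t && ~~ T (h + t).
  case: (boolP (T h && ~~ S h)) => [/andP[Th Sh]|].
    by have [t Tt Tht] := Twit h Th Sh; exists t => _ _; rewrite Tt.
  by move=> nTS; exists 0 => Th Sh; rewrite Th Sh in nTS.
have subST s : S s -> T s by move=> Ss; have := ST s 0 Ss T0; rewrite addn0.
have Tle x : ~~ T x -> x <= F by apply: contraNT; rewrite -ltnNge => /Tbig.
have main s h : (s, h) \in boxes S F.+1 ->
    move_box S T F b a t (s, h) \in boxes T F.+1 /\
    unmove_box S T F b a a' (move_box S T F b a t (s, h)) = (s, h).
  rewrite mem_boxes ltnS => /and4P[Ss Sh sh hF]; rewrite /move_box.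
  case: (boolP (T h)) => Th /=; last first.
    by rewrite mem_boxes subST // Th sh ltnS hF Ss.
  have TFs : ~~ T (F - s).
    by apply: contra TF => /(ST _ _ Ss); rewrite subnKC // ltnW // (leq_trans sh).
  have h_lt : h < F by rewrite ltn_neqAle hF andbT; apply: contraNneq TF => <-.
  have sF : s <= F by exact: ltnW (leq_trans sh hF).
  case: ifP => [/andP[TFh SFh]|DFh] /=.
    rewrite mem_boxes TFh TFs (negPf SFh) !subKn // Ss Th Sh ltnS leq_subr.
    by rewrite ltn_sub2l // (leq_trans sh).
  have /andP[Tt Tht] := tP h Th Sh.
  have St : ~~ S (t h).
    by apply: contra Tht => Stt; rewrite addnC; apply: ST.
  have t_gt0 : 0 < t h.
    by rewrite lt0n; apply: contraNneq Tht => ->; rewrite addn0.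
  (* h + t h cannot be F, for then F - h = t h would be in T but not in S *)
  have htF : h + t h < F.
    rewrite ltn_neqAle Tle // andbT; apply/eqP => htF.
    by move: DFh; rewrite -htF addKn Tt St.
  case: eqP => [s0|/eqP s_n0] /=.
    by rewrite mem_boxes Th TF h_lt ltnSn (negPf Sh) subnn S0 DFh s0.
  have s_gt0 : 0 < s by rewrite lt0n.
  have [s_le_b s_in] := Ssmall s Ss s_gt0 (ltn_trans sh h_lt).
  have ssF := Sdepth _ Ss s_gt0; have bbF := Sdepth _ Sb b_gt0.
  have SFht : ~~ S (F - (h + t h)).
    apply/negP => /Sdepth; clear -htF ssF sh; lia.
  have nlt : (h + t h + b < F) = false by clear -s_le_b ssF sh; lia.
  case: eqP => [sb|/eqP s_nb] /=.
    have bh : b < h by rewrite -sb.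
    have Tw : ~~ T (h - b + t h).
      apply: contra Tht => /(ST _ _ Sb).
      by rewrite addnA subnKC // ltnW.
    (* an element of S in this place would be small and exceed b *)
    have SFw : ~~ S (F - (h - b + t h)).
      apply/negP => /Ssmall; clear -bh htF t_gt0; lia.
    rewrite mem_boxes Tt Tw (negPf St) (negPf SFw).
    have -> : h - b + t h + b < F by clear -bh htF; lia.
    clear -bh htF sb; split; first lia.
    by congr pair; lia.
  have t_lt : h + t h - h < h by clear -ssF sh htF; lia.
  case: eqP => [sa|/eqP s_na] /=.
    rewrite mem_boxes Th Tht (negPf Sh) (negPf SFht) nlt t_lt sa.
    by clear -htF t_gt0; split; first lia.
  rewrite mem_boxes Tt Tht (negPf St) (negPf SFht) nlt addnK.
  have -> : (h < t h) = false by clear -t_lt; lia.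
  move: s_in; rewrite (negPf s_nb) (negPf s_na) => /= /eqP <-.
  by clear -htF sh; split; first lia.
rewrite -(size_map (move_box S T F b a t)).
apply: uniq_leq_size => [|_ /mapP[[s h] /main[sh_in _] ->] //].
rewrite map_inj_in_uniq ?uniq_boxes // => -[s h] [s' h'] /main[_ E] /main[_ E'] EE.
by rewrite -E -E' EE.
Qed.

(** * The numerical set of a partition *)

(** The up step of the profile that closes row [i], counted from the lower left
    corner; it is also the hook length of the first box of that row. *)
Definition bead (la : seq nat) (i : nat) : nat := nth 0 la i + (size la - i.+1).

Definition profile_set (la : seq nat) : pred nat :=
  fun u => u \notin mkseq (bead la) (size la).

(** The position of the right step under column [j]: it is preceded by [j] right
    steps and by the up steps of the rows with at most [j] boxes. *)
Definition right_step (la : seq nat) (j : nat) : nat :=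
  j + (size la - count (ltn j) la).

(** The rows that meet column [j] are the first ones, so that comparisons with the
    parts of [la] turn into comparisons with the parts of its conjugate. *)
Lemma nth_gt_conjugate la i j : sorted geq la ->
  (j < nth 0 la i) = (i < count (ltn j) la).
Proof.
elim: la i => [|v la IH] i; first by rewrite nth_nil.
rewrite /= => v_la; have := path_sorted v_la => /IH {}IH.
have [jv|vj] := ltnP j v; first by case: i => [|i] /=; rewrite ?jv // IH.
have /allP la_le : all (geq v) la by apply: order_path_min v_la => ? ? ? /=; lia.
have c0 : count (ltn j) la = 0.
  by apply/eqP; rewrite -leqn0 leqNgt -has_count; apply/hasPn => x /la_le /=; lia.
by rewrite c0; case: i => [|i] /=; rewrite ?IH ?c0; lia.
Qed.

Lemma count_ltn_iota c a l : c <= a + l ->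
  count (fun k => k < c) (iota a l) = c - a.
Proof.
elim: l a => [|l IH] a /=; first by lia.
by move=> ?; rewrite IH; lia.
Qed.

Lemma right_step_lt_bead la i j : sorted geq la -> i < size la ->
  (right_step la j < bead la i) = (j < nth 0 la i).
Proof.
move=> la_s i_n; rewrite /right_step /bead.
have := nth_gt_conjugate i j la_s; have := count_size (ltn j) la; lia.
Qed.

(** Strictly between the right step under column [j] and the up step closing row
    [i], the profile makes one right step per box of the arm and one up step per
    box of the leg. *)
Lemma hook_lengthE la i j : sorted geq la -> in_diagram la i j ->
  right_step la j + hook_length la i j = bead la i.
Proof.
move=> la_s; rewrite /in_diagram /hook_length /arm /leg /in_diagram => ij.
have i_n : i < size la by rewrite ltnNge; apply/negP => ?; rewrite nth_default in ij.
under eq_count => k do rewrite nth_gt_conjugate //.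
have := nth_gt_conjugate i j la_s; have := count_size (ltn j) la => c_n ijc.
by rewrite count_ltn_iota /right_step /bead; lia.
Qed.

Lemma mem_beads la x :
  reflect (exists2 i, i < size la & x = bead la i) (~~ profile_set la x).
Proof.
rewrite negbK; apply: (iffP mapP) => -[i i_n ->]; exists i => //; move: i_n.
  by rewrite mem_iota.
by rewrite mem_iota.
Qed.

Lemma bead_decr la i k : sorted geq la -> i < k -> k < size la -> bead la k < bead la i.
Proof.
move=> la_s ik k_n; rewrite /bead.
have := nth_gt_conjugate i (nth 0 la i) la_s.
have := nth_gt_conjugate k (nth 0 la i) la_s; lia.
Qed.

Lemma uniq_beads la : sorted geq la -> uniq (mkseq (bead la) (size la)).
Proof.
move=> la_s; rewrite map_inj_in_uniq ?iota_uniq // => i k; rewrite !mem_iota.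
rewrite /= !add0n => i_n k_n; case: (ltngtP i k) => // /(bead_decr la_s).
  by move=> /(_ k_n) /[swap] ->; rewrite ltnn.
by move=> /(_ i_n) /[swap] ->; rewrite ltnn.
Qed.

(** If [t] is not a bead and [p] beads lie below [t], they belong to the last [p]
    rows, which are those with at most [t - p] boxes; so [t] is the right step
    under column [t - p]. *)
Lemma profile_set_right_step la t : sorted geq la ->
  reflect (exists j, t = right_step la j) (profile_set la t).
Proof.
move=> la_s; apply: (iffP idP) => [Tt|[j ->]]; last first.
  apply: contraT => /mem_beads[i i_n].
  rewrite /right_step /bead.
  have := nth_gt_conjugate i j la_s; have := count_size (ltn j) la; lia.
have notbead i : i < size la -> t <> bead la i.
  by move=> i_n E; move: Tt; apply/negP/mem_beads; exists i.
(* q counts the rows whose bead is above t; they are those that meet the column *)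
pose q := find (fun i => bead la i < t) (iota 0 (size la)).
have q_n : q <= size la by rewrite -[X in _ <= X](size_iota 0) find_size.
have below : q < size la -> bead la q < t.
  move=> qn; have := @nth_find _ 0 (fun i => bead la i < t) (iota 0 (size la)).
  by rewrite has_find size_iota -/q nth_iota // => /(_ qn).
have above i : i < q -> t < bead la i.
  move=> iq; have i_n := leq_trans iq q_n.
  have := @before_find _ 0 (fun i => bead la i < t) _ _ iq.
  by rewrite nth_iota //= add0n; have := notbead i i_n; lia.
have t_ge : size la - q <= t.
  case: (ltnP q (size la)) => [/below|]; rewrite /bead; lia.
exists (t - (size la - q)).
suff -> : right_step la (t - (size la - q)) =
          (t - (size la - q)) + (size la - q) by rewrite subnK.
congr (_ + (_ - _)); set j := t - _.
have c_n := count_size (ltn j) la.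
apply/eqP; rewrite eqn_leq; apply/andP; split.
  rewrite leqNgt -nth_gt_conjugate //.
  case: (ltnP q (size la)) => [/below|qn]; last by rewrite nth_default.
  by rewrite /bead /j; lia.
case: q @j c_n q_n above t_ge {below} => // q j c_n q_n above t_ge.
rewrite -nth_gt_conjugate //.
by have := above q (ltnSn q); rewrite /bead /j; lia.
Qed.

(** For [h] in the right-hand side, the right step [t] lies under some column and
    the up step [t + h] closes some row; they cross in a box because [0 < h]. *)
Lemma hook_lengthsP la h : sorted geq la ->
  hook_lengths la h <->
  [/\ 0 < h & exists2 t, profile_set la t & ~~ profile_set la (t + h)].
Proof.
move=> la_s; split=> [[i [j [ij ->]]]|[h_gt0 [t /profile_set_right_step[//|j ->]]]].
  split; first by rewrite /hook_length addn1.
  exists (right_step la j); first by apply/profile_set_right_step => //; exists j.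
  rewrite hook_lengthE //; apply/mem_beads; exists i => //.
  by rewrite ltnNge; apply/negP => ?; rewrite /in_diagram nth_default in ij.
case/mem_beads => i i_n E; exists i, j.
have ij : in_diagram la i j by rewrite /in_diagram -right_step_lt_bead // -E; lia.
by split=> //; have := hook_lengthE la_s ij; lia.
Qed.

(** The right steps before the up step closing row [i] are those under its boxes. *)
Lemma count_profile_set la i : sorted geq la -> i < size la ->
  count (profile_set la) (iota 0 (bead la i)) = nth 0 la i.
Proof.
move=> la_s i_n; rewrite -size_filter -[RHS](size_iota 0) -[RHS](size_map (right_step la)).
apply: perm_size; apply: uniq_perm; first by rewrite filter_uniq ?iota_uniq.
  rewrite map_inj_in_uniq ?iota_uniq // => j k _ _.
  have mono a b : a < b -> right_step la a < right_step la b.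
    move=> ab; rewrite /right_step.
    have : count (ltn b) la <= count (ltn a) la by apply: sub_count => x /=; lia.
    by have := count_size (ltn a) la; lia.
  by case: (ltngtP j k) => // /mono; lia.
move=> u; rewrite mem_filter mem_iota add0n /=; apply/andP/mapP.
  case=> /profile_set_right_step[//|j ->]; rewrite right_step_lt_bead // => ij.
  by exists j; rewrite ?mem_iota.
case=> j; rewrite mem_iota add0n /= => ij ->; rewrite right_step_lt_bead //.
by split=> //; apply/profile_set_right_step => //; exists j.
Qed.

Lemma sumn_boxes la N : sorted geq la ->
  (forall x, N <= x -> profile_set la x) -> sumn la = size (boxes (profile_set la) N).
Proof.
move=> la_s Tbig; rewrite (size_boxes_perm (xs := mkseq (bead la) (size la))).
- congr sumn; rewrite -[LHS](mkseq_nth 0) -map_comp; apply/eq_in_map => i.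
  by rewrite mem_iota => i_n /=; rewrite count_profile_set.
- exact: uniq_beads.
- move=> x; rewrite negbK; case: (boolP (x \in _)) => //= x_in.
  by rewrite ltnNge; symmetry; apply: contraL x_in => /Tbig.
Qed.

(** * Invariants of a numerical semigroup *)

Lemma gap_lt_bigmax (S : set nat) x : finite_set (gaps S) -> ~ S x ->
  x < \max_(y <- fset_set (gaps S)) y.+1.
Proof.
move=> finS Sx; apply: (leq_bigmax_seq x) => //.
by rewrite in_fset_set // inE.
Qed.

Lemma frobenius_nat (S : set nat) : finite_set (gaps S) ->
  (0 <= frobenius S)%R ->
  exists F : nat, [/\ frobenius S = F%:Z%R, ~ S F & forall x, F < x -> S x].
Proof.
move=> finS; have lt_max x := @gap_lt_bigmax S x finS; move: lt_max.
rewrite /frobenius; case Emax: (\max_(y <- _) y.+1) => [|F] lt_max //.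
move=> _; exists F; split; first by lia.
  move=> SF; have : \max_(y <- fset_set (gaps S)) y.+1 <= F.
    apply/bigmax_leqP_seq => y; rewrite in_fset_set // inE => Sy _.
    have := lt_max y Sy; rewrite ltnS leq_eqVlt => /predU1P[yF|//].
    by rewrite yF in Sy.
  by rewrite Emax ltnn.
by move=> x Fx; apply: contrapT => /lt_max; rewrite ltnS leqNgt Fx.
Qed.

Lemma multiplicityP (S : set nat) : finite_set (gaps S) ->
  is_multiplicity S (multiplicity S).
Proof.
move=> finS; apply: getPex.
set M := \max_(y <- fset_set (gaps S)) y.+1.
have SM : S M.+1.
  by apply: contrapT => /(gap_lt_bigmax finS); rewrite -/M ltnNge leqnSn.
have exM : exists n, (n \in S) && (0 < n) by exists M.+1; rewrite mem_set.
case: (ex_minnP exM) => m /andP[/set_mem Sm m_gt0] m_min.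
by exists m; split => // n Sn n_gt0; apply: m_min; rewrite mem_set.
Qed.

Lemma size_le_card (A : set nat) l n : uniq l -> (forall x, x \in l -> A x) ->
  A #<= `I_n -> size l <= n.
Proof.
move=> l_uniq lA /pcard_leP[f]; rewrite -(size_map f) -[X in _ <= X](size_iota 0).
apply: uniq_leq_size => [|_ /mapP[x /lA Ax ->]].
  by rewrite map_inj_in_uniq // => x y /lA Ax /lA Ay; apply: 'inj_f; rewrite inE.
by rewrite mem_iota; apply: 'funS_f.
Qed.

(** With fewer than three entries some of [b], [a] and [a'] coincide. *)
Lemma sorted_cover3 l : sorted ltn l -> 0 < size l <= 3 ->
  exists b a a', b \in l /\
    forall s, s \in l -> s <= b /\ [|| s == b, s == a | s == a'].
Proof.
case: l => [|x [|y [|z [|//]]]] //= l_s _.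
- by exists x, x, x; split=> [|s]; rewrite !inE // => /eqP->; rewrite eqxx.
- exists y, x, x; split=> [|s]; rewrite !inE ?eqxx ?orbT //.
  by case/orP=> /eqP ->; rewrite eqxx ?orbT; split=> //; lia.
- exists z, y, x; split=> [|s]; rewrite !inE ?eqxx ?orbT //.
  by case/or3P=> /eqP ->; rewrite eqxx ?orbT; split=> //; lia.
Qed.

Lemma sumn_enumeration (S : set nat) F : finite_set (gaps S) ->
  (forall x, F < x -> S x) ->
  sumn (enumeration S) = size (boxes (fun u => u \in S) F.+1).
Proof.
move=> finS Sbig; rewrite /enumeration.
rewrite (perm_sumn (permEl (perm_sort _ _))).
rewrite (size_boxes_perm (xs := fset_set (gaps S))) ?fset_uniq // => x.
rewrite in_fset_set // in_setC; case: (boolP (x \in S)) => //= Sx.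
by rewrite ltnS leqNgt; symmetry; apply: contra Sx => /Sbig /mem_set.
Qed.

(** * Minimality *)

Theorem theorem1p7 (S : set nat) (hS : numerical_semigroup S)
  (hdepth : has_depth S 2) (hsmall : small_elements S #<= `I_3) :
  lambda_minimal S.
Proof.
case: hS => -[S0 finS] SD la [/andP[la_s la_0] hookE].
have [Sm m_gt0 m_min] := multiplicityP finS.
move: hdepth hsmall; rewrite /has_depth /small_elements.
move: (multiplicity S) Sm m_gt0 m_min => m Sm m_gt0 m_min hdepth.
have [|F [FE SF Sbig]] := frobenius_nat finS; first by lia.
rewrite FE in hdepth * => hsmall.
have {hdepth}[mF F2m] : m < F /\ F < m + m.
  have : m <> F by move=> mF; rewrite mF in Sm.
  by lia.
pose T := profile_set la.
have gapP h : ~ S h <-> [/\ 0 < h & exists2 t, T t & ~~ T (t + h)].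
  by rewrite -hook_lengthsP // hookE.
(* a bead is positive because the parts are *)
have T0 : T 0.
  apply: contraT => /mem_beads[i i_n]; rewrite /bead => la_i0.
  by have := mem_nth 0 i_n; rewrite (_ : nth 0 la i = 0) ?(negPf la_0) //; lia.
(* as 0 is in T, each point outside T is a hook length *)
have Tbig x : F < x -> T x.
  move=> Fx; apply: contraT => Tx; suff: ~ S x by move=> /(_ (Sbig x Fx)).
  by apply/gapP; split; [exact: leq_ltn_trans Fx | exists 0].
(* F is a hook length x - t, and t > 0 would put x above F *)
have TF : ~~ T F.
  have /gapP[_ [[|t] _ //]] := SF.
  by rewrite Tbig // addSn ltnS leq_addl.
rewrite (sumn_enumeration finS Sbig) (sumn_boxes (N := F.+1)) // -/T.
pose l := [seq s <- iota 1 F.-1 | s \in S].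
have l_in s : (s \in l) = [&& s \in S, 0 < s & s < F].
  rewrite mem_filter mem_iota add1n prednK //; exact: leq_ltn_trans mF.
have l_size : 0 < size l <= 3.
  apply/andP; split.
    have : m \in l by rewrite l_in mem_set // m_gt0.
    by case: (l).
  apply: size_le_card hsmall; first by rewrite filter_uniq ?iota_uniq.
  by move=> s; rewrite l_in => /and3P[/set_mem Ss s_gt0 sF]; split=> //; lia.
have l_sorted : sorted ltn l.
  by apply: sorted_filter (iota_ltn_sorted _ _); apply: ltn_trans.
have [b [a [a' [b_in l_cover]]]] := sorted_cover3 l_sorted l_size.
move: b_in; rewrite l_in => /and3P[Sb b_gt0 _].
apply: (@size_boxes_le _ _ F b a a') => //.
- exact: mem_set.
- move=> s t /set_mem Ss Tt; apply: contraT => Tst.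
  have [s0|s_gt0] := posnP s; first by rewrite s0 Tt in Tst.
  suff: ~ S s by [].
  by apply/gapP; split=> //; exists t; rewrite // addnC.
- move=> h _ /negP Sh; have /gapP[_ [t Tt Tth]] : ~ S h by move=> /mem_set.
  by exists t; rewrite // addnC.
- move=> s /set_mem Ss s_gt0; have := m_min s Ss s_gt0; lia.
- by move=> s Ss s_gt0 sF; apply: l_cover; rewrite l_in Ss s_gt0.
Qed.
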